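(* Let $n\ge 3$, let $\beta=(\beta_1,\ldots,\beta_n)\in\{0,1\}^n$, let $r=\beta_1+\cdots+\beta_n$, and let $s\in\{0,1\}$ be such that $(-1)^s=(-1)^r$. Then the matrix $A_\beta$ has the eigenvalues (the complete list, counted with multiplicity) $$\mu^\beta_j = 2\cos\frac{(2j+s)\pi}{n},\qquad j=0,1,\ldots,n-1,$$ which equal $$2\cos\frac{2j\pi}{n},\quad j=0,1,\ldots,n-1,$$ if $r$ is even, and $$2\cos\frac{(2j+1)\pi}{n},\quad j=0,1,\ldots,n-1,$$ if $r$ is odd.
   Context: Let $B$ be the $n\times n$ real matrix whose $(i,i+1)$ entries equal $1$ for $i=1,\ldots,n-1$, whose $(n,1)$ entry equals $1$, and whose other entries are $0$. For $\beta=(\beta_1,\ldots,\beta_n)\in\{0,1\}^n$ put $\sigma_i=(-1)^{\beta_i}$, and let $B_\beta$ be the matrix obtained from $B$ by multiplying the $i$th column by $\sigma_i$, for every $i=1,\ldots,n$. The matrix $B_\beta$ is orthogonal, so its transpose $B_\beta'$ equals $B_\beta^{-1}$. Put $A_\beta=B_\beta+B_\beta'=B_\beta+B_\beta^{-1}$. (This is the adjacency matrix of the cycle of length $n$ on vertices $v_1,\ldots,v_n$ in which the edge $e_i=v_{i-1}v_i$, with $v_0=v_n$, carries the sign $\sigma_i$.) *)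

(* Defs.v *)
From HB Require Import structures.
From mathcomp Require Import all_boot all_order all_algebra.
From mathcomp Require Import all_classical all_reals all_analysis.

Set Implicit Arguments.
Unset Strict Implicit.
Unset Printing Implicit Defensive.

Import Order.TTheory GRing.Theory Num.Theory.
Local Open Scope ring_scope.

(* Indices are 0-based: i : 'I_n stands for the mathematical index i + 1, so
   the corner entry (n, 1) is the entry (n - 1, 0) here. *)
Definition cycleB {R : pzRingType} (n : nat) : 'M[R]_n :=
  \matrix_(i < n, j < n)
    (if (j == i.+1 :> nat) || ((i.+1 == n) && (j == 0%N :> nat))
     then 1 else 0).

Definition edge_sign {R : pzRingType} (n : nat) (beta : 'I_n -> bool)
    (i : 'I_n) : R :=
  (-1) ^+ beta i.

Definition signedB {R : pzRingType} (n : nat) (beta : 'I_n -> bool) : 'M[R]_n :=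
  \matrix_(i < n, j < n) (cycleB n i j * edge_sign beta j).

Definition signedA {R : pzRingType} (n : nat) (beta : 'I_n -> bool) : 'M[R]_n :=
  signedB beta + (signedB beta)^T.

Lemma signedB_orthogonal (R : comUnitRingType) (n : nat) (beta : 'I_n -> bool) :
  signedB beta *m (signedB beta)^T = 1%:M :> 'M[R]_n.
Proof.
apply/matrixP => i k; rewrite !mxE.
have E (a j : 'I_n) : (j == a.+1 :> nat) || ((a.+1 == n) && (j == 0%N :> nat))
    = (j == ordS a).
  rewrite -(inj_eq val_inj) /=; case: (ltngtP a.+1 n) (ltn_ord a) => // h _.
    by rewrite modn_small // orbF.
  by rewrite h modnn ltn_eqF.
rewrite (bigD1 (ordS i)) //= !mxE !E eqxx mul1r big1 => [|j /negPf ji].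
  rewrite addr0 (inj_eq (@ordS_inj n)); case: (i == k); last first.
    by rewrite mul0r mulr0.
  by rewrite mul1r -expr2 sqrr_sign.
by rewrite !mxE E ji !mul0r.
Qed.

Lemma signedAE (R : comUnitRingType) (n : nat) (beta : 'I_n -> bool) :
  signedA beta = signedB beta + invmx (signedB beta) :> 'M[R]_n.
Proof.
have BBT := signedB_orthogonal R beta; have [uB _] := mulmx1_unit BBT.
by rewrite /signedA -[(signedB beta)^T]mul1mx -(mulVmx uB) -mulmxA BBT mulmx1.
Qed.

Definition mu {R : realType} (n : nat) (s : bool) (j : 'I_n) : R :=
  2 * cos ((2 * j + s)%N%:R * pi / n%:R).

(* The sequence l is the complete list of eigenvalues of A, each repeated
   according to its algebraic multiplicity. *)
Definition eigenvalues_of {R : comNzRingType} (n : nat) (A : 'M[R]_n)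
    (l : seq R) : Prop :=
  char_poly A = \prod_(a <- l) ('X - a%:P).

(* Main.v *)
Require Import Defs.
From HB Require Import structures.
From mathcomp Require Import all_boot all_order all_algebra.
From mathcomp Require Import all_classical all_reals all_analysis.
From mathcomp Require Import complex lra.

Import Order.TTheory GRing.Theory Num.Theory.
Local Open Scope ring_scope.

(** Write c for the product of all the signs, so that c is 1 or -1. The signed
    shift B sends the basis row vector of index i to a signed copy of the one
    of index i + 1 (cyclically), so its n-th power is c: its eigenvalues must
    be n-th roots of c. Conversely, every root x of x ^+ n = c gives the row
    eigenvector whose k-th entry is x ^+ k times the product of the first
    signs, with eigenvalue x^-1 ([signed_vandermonde_eigen]). For n distinct
    roots these eigenvectors are the rows of a Vandermonde matrix with rescaled
    columns, hence form a basis ([signed_vandermonde_unit]).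

    As B is orthogonal, its transpose acts on the same basis with the inverse
    eigenvalues. Therefore B + B^T is diagonalized, with eigenvalues x + x^-1,
    and its characteristic polynomial splits accordingly. This part holds over
    any field that contains n distinct roots of c ([char_poly_signedA]).

    For a real matrix the roots are supplied by the complex numbers
    x_j = exp (i (2 j + s) pi / n), which satisfy x_j ^+ n = (-1) ^+ s = c, are
    distinct ([expi_cycle_angle_inj]), and have x_j + x_j^-1 equal to
    2 cos ((2 j + s) pi / n). The factorization over the complex numbers
    descends to the reals because the embedding of polynomials is injective. *)

(** * Diagonalization over a field with enough roots *)

(** The determinant of V is a nonzero constant polynomial, so it cancels from
    the equality of determinants V (X - A) = (X - D) V. *)
Lemma char_poly_intertwine (F : fieldType) (n : nat) (V A D : 'M[F]_n) :
  V \in unitmx -> V *m A = D *m V -> char_poly A = char_poly D.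
Proof.
move=> uV VA; have detV : (\det V)%:P != 0 :> {poly F}.
  by rewrite polyC_eq0 -unitfE -unitmxE.
apply: (mulfI detV); rewrite [RHS]mulrC -det_map_mx /= /char_poly -!det_mulmx.
congr (\det _); rewrite /char_poly_mx mulmxBr mulmxBl -!map_mxM VA.
by rewrite scalar_mxC.
Qed.

Lemma signedBE (R : pzRingType) (n : nat) (beta : 'I_n -> bool) (i j : 'I_n) :
  signedB beta i j = if j == ordS i then edge_sign beta j else 0 :> R.
Proof.
rewrite !mxE.
have -> : (j == i.+1 :> nat) || ((i.+1 == n) && (j == 0%N :> nat))
    = (j == ordS i).
  rewrite -(inj_eq val_inj) /=; case: (ltngtP i.+1 n) (ltn_ord i) => // h _.
    by rewrite modn_small // orbF.
  by rewrite h modnn ltn_eqF.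
by case: eqP => _; rewrite ?mul1r ?mul0r.
Qed.

(** The product includes the sign of index 0. It contributes the same factor to
    every entry of an eigenvector, hence is harmless, and it makes the product
    over all indices appear at the last index, where the cycle closes. *)
Definition prefix_sign {R : pzRingType} {n : nat} (beta : 'I_n -> bool)
    (k : 'I_n) : R :=
  \prod_(i < n | (i <= k)%N) edge_sign beta i.

Lemma prefix_sign_neq0 (F : fieldType) (n : nat) (beta : 'I_n -> bool) k :
  prefix_sign beta k != 0 :> F.
Proof. by apply/prodf_neq0 => i _; rewrite signr_eq0. Qed.

(** The index j only serves to ensure n > 0, without which x could be 0. *)
Lemma root_prod_sign_neq0 (F : fieldType) (n : nat) (beta : 'I_n -> bool)
    (x : F) (j : 'I_n) :
  x ^+ n = \prod_(i < n) edge_sign beta i -> x != 0.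
Proof.
apply: contra_eq_neq => ->.
rewrite expr0n gtn_eqF ?(leq_ltn_trans _ (ltn_ord j)) //.
by rewrite eq_sym; apply/prodf_neq0 => i _; rewrite signr_eq0.
Qed.

(** Row j is the candidate eigenvector attached to z j. *)
Definition signed_vandermonde {F : fieldType} {n : nat} (beta : 'I_n -> bool)
    (z : 'I_n -> F) : 'M[F]_n :=
  \matrix_(j < n, k < n) (z j ^+ k * prefix_sign beta k).

Lemma signed_vandermonde_unit (F : fieldType) (n : nat) (beta : 'I_n -> bool)
    (z : 'I_n -> F) :
  injective z -> signed_vandermonde beta z \in unitmx.
Proof.
move=> z_inj.
have -> : signed_vandermonde beta z =
    (Vandermonde n (\row_j z j))^T *m diag_mx (\row_k prefix_sign beta k).
  by apply/matrixP => j k; rewrite mul_mx_diag !mxE.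
rewrite unitmxE det_mulmx det_tr det_Vandermonde det_diag unitfE mulf_neq0 //.
  apply/prodf_neq0 => i _; apply/prodf_neq0 => j lt_ij.
  by rewrite !mxE subr_eq0 (inj_eq z_inj) -val_eqE gtn_eqF.
by apply/prodf_neq0 => k _; rewrite mxE prefix_sign_neq0.
Qed.

(** Column k of B has its only nonzero entry in row k - 1, so moving one step
    along the cycle must multiply an entry by z j and by the sign of the new
    index. That is how the entries are built, except for the step from n - 1
    back to 0, where the requirement becomes the equation for z j ^+ n. *)
Lemma signed_vandermonde_eigen (F : fieldType) (n : nat) (beta : 'I_n -> bool)
    (z : 'I_n -> F) :
  (forall j, z j ^+ n = \prod_(i < n) edge_sign beta i) ->
  signed_vandermonde beta z *m signedB beta =
    diag_mx (\row_j (z j)^-1) *m signed_vandermonde beta z.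
Proof.
move=> zn; apply/matrixP => j k; rewrite mul_diag_mx !mxE.
have z0 := root_prod_sign_neq0 _ _ _ _ j (zn j).
have [i ->] : exists i, k = ordS i by exists (ord_pred k); rewrite ord_predK.
rewrite (bigD1 i) //= signedBE eqxx big1 => [|l ne_li]; last first.
  by rewrite signedBE (inj_eq (@ordS_inj n)) eq_sym (negPf ne_li) mulr0.
rewrite addr0 !mxE /prefix_sign /=; have := ltn_ord i.
rewrite leq_eqVlt => /predU1P[eq_in | lt_in].
  (* The closing step from n - 1 to 0. The product of all signs is z j ^+ n,
     and it is its own inverse. *)
  have -> : \prod_(l < n | (l <= i)%N) edge_sign beta l = z j ^+ n.
    by rewrite zn; apply: eq_bigl => l; rewrite -ltnS eq_in ltn_ord.
  have -> : \prod_(l < n | (l <= i.+1 %% n)%N) edge_sign beta l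
      = edge_sign beta (ordS i) :> F.
    rewrite (bigD1 (ordS i)) //= big1 ?mulr1 // => l /andP[].
    by rewrite -val_eqE /= eq_in modnn leqn0 => /eqP ->.
  have zz : z j ^+ n * z j ^+ n = 1.
    by rewrite zn -big_split big1 //= => l _; rewrite -expr2 sqrr_sign.
  rewrite eq_in modnn expr0 mul1r; congr (_ * _).
  by apply: (mulfI z0); rewrite mulfV // mulrA -exprS eq_in.
(* An inner step: the prefix product gains the single factor of index i + 1. *)
rewrite modn_small // [in RHS](bigD1 (ordS i)) /= ?modn_small //.
rewrite exprS -!mulrA mulKf //; congr (_ * _); rewrite mulrC; congr (_ * _).
by apply: eq_bigl => l; rewrite -val_eqE /= modn_small // andbC -ltn_neqAle.
Qed.

Lemma char_poly_signedA (F : fieldType) (n : nat) (beta : 'I_n -> bool)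
    (z : 'I_n -> F) :
  injective z -> (forall j, z j ^+ n = \prod_(i < n) edge_sign beta i) ->
  char_poly (signedA beta) = \prod_(j < n) ('X - (z j + (z j)^-1)%:P).
Proof.
move=> z_inj zn; set V := signed_vandermonde beta z.
have z0 j := root_prod_sign_neq0 _ _ _ _ j (zn j).
have VB := signed_vandermonde_eigen _ _ _ _ zn; rewrite -/V in VB.
(* B^T is the inverse of B, so it has the same eigenvectors, with the
   inverse eigenvalues. *)
have VBT : V *m (signedB beta)^T = diag_mx (\row_j z j) *m V.
  have VE : V = diag_mx (\row_j z j) *m (V *m signedB beta).
    rewrite VB mulmxA mulmx_diag -[LHS]mul1mx; congr (_ *m _).
    by apply/matrixP => i j; rewrite !mxE mulfV.
  by rewrite [in LHS]VE -!mulmxA signedB_orthogonal mulmx1.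
rewrite (@char_poly_intertwine _ _ V _ (diag_mx (\row_j (z j + (z j)^-1)))).
- rewrite char_poly_trig ?diag_mx_is_trig //.
  by apply: eq_bigr => j _; rewrite !mxE eqxx mulr1n.
- exact: signed_vandermonde_unit.
rewrite mulmxDr VB VBT -mulmxDl -raddfD /=; congr (diag_mx _ *m _).
by apply/rowP => j; rewrite !mxE addrC.
Qed.

(** * Complex roots of 1 and -1 *)

Definition expi {R : realType} (x : R) : R[i] := Complex (cos x) (sin x).

Lemma expiD (R : realType) (x y : R) : expi (x + y) = expi x * expi y.
Proof. by rewrite /expi cosD sinD; congr Complex; rewrite addrC. Qed.

Lemma expi_natmul (R : realType) (x : R) k : expi (x *+ k) = expi x ^+ k.
Proof.
elim: k => [|k IH]; first by rewrite mulr0n expr0 /expi cos0 sin0.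
by rewrite mulrS expiD IH exprS.
Qed.

Lemma expi_pi (R : realType) : expi (pi : R) = -1.
Proof. by rewrite /expi cospi sinpi -[X in Complex _ X]oppr0. Qed.

Lemma expi_addV (R : realType) (x : R) :
  expi x + (expi x)^-1 = real_complex R (2 * cos x).
Proof.
have xN : expi x * expi (- x) = 1 by rewrite -expiD subrr /expi cos0 sin0.
have x0 : expi x != 0.
  by apply: contra_eq_neq xN => ->; rewrite mul0r eq_sym oner_eq0.
have -> : (expi x)^-1 = expi (- x) by apply: (mulfI x0); rewrite mulfV.
apply/eqP; rewrite eq_complex /expi cosN sinN /=.
by rewrite subrr mulr_natl mulr2n !eqxx.
Qed.

(** Half-angle argument: cos x = 1 - 2 sin (x / 2) ^ 2, and sin is positive at
    x / 2, which lies strictly between 0 and pi. *)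
Lemma expi_neq1 (R : realType) (x : R) : 0 < x < pi *+ 2 -> expi x != 1.
Proof.
move=> /andP[x0 x2]; apply/eqP => -[cosx _].
have : 0 < sin (x / 2).
  by apply: sin_gt0_pi; rewrite divr_gt0 //= ltr_pdivrMr // mulr_natr.
have := cos_mulr2n (x / 2); have := cos2Dsin2 (x / 2).
have -> : x / 2 *+ 2 = x by rewrite -mulr_natr mulfVK.
rewrite cosx; nra.
Qed.

Definition cycle_angle {R : realType} {n : nat} (s : bool) (j : 'I_n) : R :=
  (2 * j + s)%N%:R * pi / n%:R.

Lemma expi_cycle_angle_expn (R : realType) (n : nat) (s : bool) (j : 'I_n) :
  expi (cycle_angle s j : R) ^+ n = (-1) ^+ s.
Proof.
have n0 : n%:R != 0 :> R.
  by rewrite pnatr_eq0 -lt0n (leq_ltn_trans _ (ltn_ord j)).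
rewrite -expi_natmul /cycle_angle -[(_ / _) *+ n]mulr_natr mulfVK //.
rewrite mulr_natl expi_natmul.
by rewrite expi_pi exprD exprM sqrrN expr1n expr1n mul1r.
Qed.

(** For k < j the angles differ by 2 (j - k) pi / n, strictly between 0 and
    2 pi, so the quotient of the two exponentials is not 1. *)
Lemma expi_cycle_angle_inj (R : realType) (n : nat) (s : bool) :
  injective (fun j : 'I_n => expi (cycle_angle s j : R)).
Proof.
move=> j k /=; wlog lt_kj : j k / (k < j)%N => [hw eq_jk|].
  apply: val_inj => /=; case: (ltngtP k j) => // h.
    by rewrite (hw j k).
  by rewrite (hw k j).
move=> eq_jk; exfalso.
have n_gt0 : (0 < n)%N by exact: leq_ltn_trans (ltn_ord j).
pose d : R := (2 * (j - k))%N%:R * pi / n%:R.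
have jkd : cycle_angle s j = cycle_angle s k + d.
  rewrite /cycle_angle /d -!mulrDl -natrD; congr (_%:R * _ / _).
  by rewrite addnAC -mulnDr subnKC // ltnW.
have : expi d != 1.
  apply: expi_neq1.
  rewrite divr_gt0 ?mulr_gt0 ?pi_gt0 ?ltr0n ?muln_gt0 ?subn_gt0 //=.
  rewrite ltr_pdivrMr ?ltr0n //.
  have -> : pi *+ 2 * n%:R = (2 * n)%N%:R * pi :> R.
    by rewrite natrM -[pi *+ 2]mulr_natl mulrAC.
  rewrite ltr_pM2r ?pi_gt0 // ltr_nat ltn_pmul2l //.
  exact: leq_ltn_trans (leq_subr _ _) (ltn_ord j).
have x0 : expi (cycle_angle s k : R) != 0.
  apply/eqP => x0; have /esym/eqP := expi_cycle_angle_expn R n s k.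
  by rewrite x0 expr0n gtn_eqF // signr_eq0.
case/eqP; apply: (mulfI x0); rewrite -expiD -jkd mulr1; exact: eq_jk.
Qed.

(** * The spectrum of a signed cycle *)

Theorem theorem2 (R : realType) (n : nat) (beta : 'I_n -> bool) (r : nat)
    (s : bool) (hn : (3 <= n)%N) (hr : r = (\sum_(i < n) beta i)%N)
    (hs : (-1) ^+ s = (-1) ^+ r :> R) :
  [/\ eigenvalues_of (signedA beta) [seq mu s j : R | j <- enum 'I_n],
      ~~ odd r ->
        forall j : 'I_n, mu s j = 2 * cos ((2 * j)%N%:R * pi / n%:R) :> R
    & odd r ->
        forall j : 'I_n, mu s j = 2 * cos ((2 * j + 1)%N%:R * pi / n%:R) :> R].
Proof.
have sE : s = odd r.
  move: hs; rewrite -[in RHS]signr_odd; case: s (odd r) => -[] // /eqP.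
    by rewrite eqNr oner_eq0.
  by rewrite eq_sym eqNr oner_eq0.
split; last 2 first.
- by rewrite -sE => /negPf -> j; rewrite /mu addn0.
- by rewrite -sE => -> j.
rewrite /eigenvalues_of big_map big_enum /=.
apply: (map_poly_inj (real_complex R)).
have mapA : map_mx (real_complex R) (signedA beta) = signedA beta.
  apply/matrixP => i j; rewrite mxE /signedA [in LHS]mxE [in RHS]mxE.
  rewrite ![(_^T) _ _]mxE rmorphD /= !signedBE.
  by congr (_ + _); case: eqP => // _; rewrite /edge_sign rmorph_sign.
rewrite map_char_poly mapA rmorph_prod.
rewrite (@char_poly_signedA _ _ _ (fun j => expi (cycle_angle s j))).
- apply: eq_bigr => j _.
  by rewrite expi_addV rmorphB /= map_polyX map_polyC.
- exact: expi_cycle_angle_inj.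
move=> j; rewrite expi_cycle_angle_expn sE signr_odd hr.
by rewrite /edge_sign -expr_sum.
Qed.
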